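(* Let $G$ be a finite group with an abelian subgroup $H$ of index $2$, and suppose that the centre of $G$ contains no involution. Let $S\subseteq G\setminus\{1_G\}$ be inverse-closed. If the Cayley graph $X=\mathrm{Cay}(G,S)$ admits perfect state transfer, then $S$ consists of a single involution and $X$ is a perfect matching. In particular, no connected Cayley graph $X=\mathrm{Cay}(G,S)$ admits perfect state transfer.
   Context: $\mathrm{Cay}(G,S)$ is the graph with vertex set $G$ in which $g\sim h$ if and only if $hg^{-1}\in S$. For a graph $X$ with adjacency matrix $A$, put $U(t)=\exp(itA)$; $X$ admits perfect state transfer if $|U(\tau)_{v,u}|=1$ for some distinct vertices $u,v$ and some time $\tau$. An involution is an element of order two. ''$X$ is a perfect matching'' means that every vertex of $X$ has degree one. *)

(* Defs.v *)
From HB Require Import structures.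
From mathcomp Require Import all_boot all_order all_algebra all_fingroup.
From mathcomp Require Import all_solvable.
From mathcomp Require Import complex.
From mathcomp Require Import boolp classical_sets reals topology normedtype.
From mathcomp Require Import sequences.

Set Implicit Arguments.
Unset Strict Implicit.
Unset Printing Implicit Defensive.

Import GRing.Theory Num.Theory.
Import numFieldNormedType.Exports.

Local Open Scope ring_scope.

(* The limit is taken in the topology of entrywise convergence, which is the
   library's topology on matrices. *)
Definition mxexp (K : numFieldType) (n : nat) (A : 'M[K]_n) : 'M[K]_n :=
  limn (series (fun k : nat => (k`!%:R)^-1 *: A ^+ k)).

Section Graph.
Variables (T : finType) (e : rel T).

(* Rows and columns are indexed by 'I_#|T|, through the enumeration of T. *)
Definition adjacency_mx (K : pzRingType) : 'M[K]_#|T| :=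
  \matrix_(i, j) (e (enum_val i) (enum_val j))%:R.

Definition transition_mx (R : realType) (t : R) : 'M[R[i]]_#|T| :=
  mxexp (('i%C * t%:C%C) *: adjacency_mx R[i]).

Definition perfect_state_transfer (R : realType) : Prop :=
  exists (u v : T) (tau : R),
    u != v /\ `|transition_mx tau (enum_rank v) (enum_rank u)| = 1.

Definition degree (x : T) : nat := #|[pred y | e x y]|.

Definition perfect_matching : Prop := forall x : T, degree x = 1%N.

Definition connected_graph : Prop := forall x y : T, connect e x y.

End Graph.

Definition Cay (gT : finGroupType) (S : {set gT}) : rel gT :=
  fun g h => (h * g^-1)%g \in S.

(* Main.v *)
(** The matrix exponential of the adjacency matrix [A] is diagonalised along
    with [A], so perfect state transfer forces [exp (i t A) = l z], where [l]
    is a scalar and [z <> 1] an element acting by left translation.  Symmetry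
    of [A] gives [z ^ 2 = 1], and [z S z = S].  If [z] were in [H], then [z]
    or [z * z ^ x], with [x] outside [H], would be a central involution; so
    [G = H ><| <[z]>], and for the same reason [H] has odd order.

    Replacing each [z * h] in [S] by [h] (the map [fold_coset]) turns [S] into
    an element [b] of the group ring [Z[H]] whose eigenvalues [a] are
    eigenvalues of [A] on [z]-invariant functions, hence [exp (i t a) = l].
    Comparing them with the eigenvalues of the trivial and of the sign
    character of [G / H] shows that, for some odd [n], all eigenvalues of
    [n (b - |S|)] are integers divisible by 4.  As [F_2[H]] is reduced, the
    coefficients of [n (b - |S|)] are then divisible by 4; but the
    coefficients of [b] are at most 2, so [b] is a multiple of [1], that is,
    [S] is contained in [{1, z}]. *)
Require Import Defs.
From mathcomp Require Import all_boot all_order all_algebra all_fingroup.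
From mathcomp Require Import all_solvable complex.
From mathcomp Require Import boolp classical_sets reals topology normedtype.
From mathcomp Require Import sequences trigo.
From mathcomp Require Import ring lra zify.

Set Implicit Arguments.
Unset Strict Implicit.
Unset Printing Implicit Defensive.

Import Order.TTheory GRing.Theory Num.Theory.
Import numFieldNormedType.Exports.

Local Open Scope ring_scope.

(** * The exponential of a matrix with real spectrum *)

Section Cis.
Variable R : realType.
Implicit Types a b t : R.

Definition cis t : R[i] := (cos t)%:C%C + 'i%C * (sin t)%:C%C.

Lemma cisE t : cis t = (cos t +i* sin t)%C.
Proof. by rewrite /cis [RHS]complexE. Qed.

Lemma cisD a b : cis (a + b) = cis a * cis b.
Proof. by rewrite !cisE cosD sinD; simpc; congr (_ +i* _)%C; rewrite addrC. Qed.

Lemma cis0 : cis 0 = 1.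
Proof. by rewrite cisE cos0 sin0. Qed.

Lemma cispi : cis pi = -1.
Proof. by rewrite cisE cospi sinpi; simpc. Qed.

Lemma conj_cis t : (cis t)^* = cis (- t).
Proof. by rewrite !cisE cosN sinN. Qed.

Lemma cis_neq0 t : cis t != 0.
Proof.
apply/negP => /eqP c0; have := cisD t (- t).
by rewrite subrr cis0 c0 mul0r => /eqP; rewrite oner_eq0.
Qed.

Lemma cisB a b : cis (a - b) = cis a / cis b.
Proof. by apply: (canRL (mulfK (cis_neq0 b))); rewrite -cisD subrK. Qed.

Lemma cis_period t (k : int) : cis (t + k%:~R * (pi *+ 2)) = cis t.
Proof.
suff cn n s : cis (s + n%:R * (pi *+ 2)) = cis s.
  case: k => n; first exact: cn.
  by rewrite NegzE mulrNz mulNr -[LHS](cn n.+1) subrK.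
rewrite mulr_natl !cisE; congr (_ +i* _)%C.
- exact: (periodicn (@cosD2pi R)).
- exact: (periodicn (@sinD2pi R)).
Qed.

(** Reduce [t] modulo 2 pi to [r] in [0, 2 pi). If [r] were nonzero, then [r / 2] would lie strictly
    between 0 and pi, where the sine is positive, while cos r = 1 - 2 sin(r / 2)^2 = 1 forces that
    sine to vanish. *)
Lemma cis_eq1 t : cis t = 1 -> exists k : int, t = k%:~R * (pi *+ 2).
Proof.
have pi2 : 0 < (pi : R) *+ 2 by rewrite pmulrn_lgt0 ?pi_gt0.
pose k := Num.floor (t / (pi *+ 2)); pose r := t - k%:~R * (pi *+ 2).
move=> t1; exists k; apply/eqP; rewrite -subr_eq0 -/r.
have [r0 r2] : 0 <= r /\ r < pi *+ 2.
  rewrite /r subr_ge0 ltrBlDr -{2}[pi *+ 2]mul1r -mulrDl -ler_pdivlMr // -ltr_pdivrMr //.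
  by rewrite Num.Theory.floor_le -(intrD _ 1 k) addrC Num.Theory.floorD1_gt.
have : cis r = 1 by rewrite /r -mulNr -mulrNz cis_period.
rewrite cisE => -[cr _]; apply/negPn/negP => rn0.
have sr : 0 < sin (r / 2).
  apply: sin_gt0_pi; rewrite ltr_pdivrMr // mulr_natr r2 andbT.
  by rewrite divr_gt0 // lt0r rn0.
have rE : r = (r / 2) *+ 2 by rewrite mulr2n -splitr.
have := cr; rewrite {1}rE cos_mulr2n cos2sin2.
move=> e; suff : sin (r / 2) ^+ 2 == 0 by rewrite sqrf_eq0 => /eqP s0; rewrite s0 ltxx in sr.
by apply/eqP; lra.
Qed.

Lemma cis_eqN1 t : cis t = -1 -> exists m : int, t = (2 * m + 1)%:~R * pi.
Proof.
move=> t1; have := @cis_eq1 (t - pi); rewrite cisB t1 cispi divff ?oppr_eq0 ?oner_eq0 //.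
by move=> /(_ erefl)[k kE]; exists k; rewrite -[t](subrK pi) kE rmorphD rmorphM /=; ring.
Qed.

End Cis.

(** * Entrywise convergence of matrices *)

Section MatrixLimit.
Local Open Scope classical_set_scope.
Variables (K : numFieldType) (m n : nat).

(** A basic neighbourhood of a matrix is a family of neighbourhoods of its entries. One entry is
    isolated by placing the whole space at all others; conversely, finitely many eventual conditions
    hold together. *)
Lemma mx_cvgP (F : nat -> 'M[K]_(m, n)) (L : 'M[K]_(m, n)) :
  (F k @[k --> \oo] --> L) <->
  (forall i j, F k i j @[k --> \oo] --> L i j).
Proof.
split=> [FL i j P LP|FL P].
  apply: (FL [set M : 'M_(m, n) | P (M i j)]).
  exists (fun a b => if (a == i) && (b == j) then P else setT).
    by move=> a b; case: ifP => [/andP[/eqP-> /eqP->]|_]; [|exact: filterT].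
  by move=> M /(_ i j) /=; rewrite !eqxx.
case=> Q LQ sQP; apply: (filterS sQP).
have H i : \forall k \near \oo, forall j, Q i j (F k i j).
  by apply: filter_forall => j; exact: (FL i j _ (LQ i j)).
exact: (@filter_forall _ _ _ \oo _ H).
Qed.

Lemma mx_cvg_lim (F : nat -> 'M[K]_(m, n)) (L : 'M[K]_(m, n)) :
  F k @[k --> \oo] --> L -> limn F = L.
Proof.
move=> FL; have FlimF : F k @[k --> \oo] --> limn F by apply: cvgP FL.
apply/matrixP => i j.
have /mx_cvgP/(_ i j) c1 := FL; have /mx_cvgP/(_ i j) c2 := FlimF.
exact: (cvg_unique _ c2 c1).
Qed.

End MatrixLimit.

(** * The exponential series at an imaginary number *)

Section CisSeries.
Local Open Scope classical_set_scope.

Lemma cvg_big_sum (K : numFieldType) (I : Type) (r : seq I) (f : I -> nat -> K) (l : I -> K) :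
  (forall i, f i k @[k --> \oo] --> l i) ->
  \sum_(i <- r) f i k @[k --> \oo] --> \sum_(i <- r) l i.
Proof.
move=> fl; elim: r => [|i r IH].
  by rewrite big_nil; under eq_fun do rewrite big_nil; exact: cvg_cst.
by rewrite big_cons; under eq_fun do rewrite big_cons; exact: cvgD.
Qed.

Variable R : realType.
Let C : numFieldType := R[i].

Lemma cvg_real_complex (f : nat -> R) (l : R) :
  f k @[k --> \oo] --> l -> ((f k)%:C%C : C) @[k --> \oo] --> (l%:C%C : C).
Proof.
move=> /cvgrPdist_lt fl; apply/(@cvgrPdist_lt C C^o) => e e0.
have eE : e = (complex.Re e)%:C%C by rewrite RRe_real // gtr0_real.
have := fl (complex.Re e); rewrite -ltcR -eE => /(_ e0).
apply: filterS => k; rewrite -ltcR -eE -rmorphB /=.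
by rewrite normc_def /= expr0n addr0 sqrtr_sqr.
Qed.

(** As i^j is i^(odd j) times a sign, the even terms are those of the cosine series and the odd ones
    those of the sine series. *)
Lemma cvg_series_cis (t : R) :
  @series C (fun k => (k`!%:R)^-1 * ('i%C * t%:C%C) ^+ k) k @[k --> \oo] --> (cis t : C).
Proof.
have E k : @series C (fun k => (k`!%:R)^-1 * ('i%C * t%:C%C) ^+ k) k =
    (series (cos_coeff t) k)%:C%C + 'i%C * (series (sin_coeff t) k)%:C%C.
  rewrite /series /= !rmorph_sum /= mulr_sumr -big_split /=.
  apply: eq_bigr => j _; rewrite exprMn /cos_coeff /sin_coeff /=.
  rewrite !rmorphM /= !fmorphV /= !rmorph_nat !rmorphXn /= rmorphN1.
  have -> : 'i%C ^+ j = 'i%C ^+ odd j * (-1) ^+ j./2 :> R[i].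
    by rewrite -{1}(odd_double_half j) exprD -mul2n exprM sqr_i.
  have jh : odd j -> j.-1./2 = j./2.
    by move=> oj; rewrite -{1}(odd_double_half j) oj /= doubleK.
  by case: (odd j) jh => [->|_] //=; rewrite ?expr0 ?expr1; ring.
have -> : (fun k => @series C (fun k => (k`!%:R)^-1 * ('i%C * t%:C%C) ^+ k) k) =
  (fun k => (series (cos_coeff t) k)%:C%C + 'i%C * (series (sin_coeff t) k)%:C%C).
  exact/funext.
rewrite /cis; apply: cvgD; last apply: cvgMr.
- by apply: cvg_real_complex; rewrite cos.unlock; exact: is_cvg_series_cos_coeff.
- by apply: cvg_real_complex; rewrite sin.unlock; exact: is_cvg_series_sin_coeff.
Qed.

End CisSeries.

(** * Functions of a diagonalised matrix *)

Section DiagonalConjugate.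
Variables (K : fieldType) (n : nat) (P : 'M[K]_n).

Lemma conj_diag_mxE (d : 'rV[K]_n) i j :
  (invmx P *m diag_mx d *m P) i j = \sum_l d 0 l * (invmx P i l * P l j).
Proof.
rewrite mul_mx_diag mxE; apply: eq_bigr => l _.
by rewrite mxE mulrAC mulrC.
Qed.

Lemma conj_diag_mxX (d : 'rV[K]_n) k : P \in unitmx ->
  (invmx P *m diag_mx d *m P) ^+ k
    = invmx P *m diag_mx (\row_j d 0 j ^+ k) *m P.
Proof.
move=> Pu; elim: k => [|k IH].
  rewrite (_ : \row_j _ = const_mx 1); last by apply/rowP => j; rewrite !mxE.
  by rewrite diag_const_mx mulmx1 mulVmx.
rewrite exprS IH -[LHS]/(_ *m _ *m _ *m _) !mulmxA mulmxK //.
congr (_ *m _); rewrite -!mulmxA mulmx_diag; congr (_ *m diag_mx _).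
by apply/rowP => j; rewrite !mxE exprS.
Qed.

(** Entrywise the hypothesis says that [X i j = 0] or [d 0 j = d' 0 i], and either alternative
    survives applying [f]. This carries relations satisfied by the adjacency matrix over to the
    transition matrix. *)
Lemma diag_mx_intertwine m (f : K -> K) (X : 'M[K]_(m, n)) (d : 'rV[K]_n) (d' : 'rV[K]_m) :
  X *m diag_mx d = diag_mx d' *m X ->
  X *m diag_mx (map_mx f d) = diag_mx (map_mx f d') *m X.
Proof.
rewrite !mul_mx_diag !mul_diag_mx => /matrixP E; apply/matrixP => i j.
have /eqP := E i j; rewrite !mxE mulrC -subr_eq0 -mulrBl mulf_eq0 subr_eq0.
by case/orP => /eqP ->; rewrite ?mulr0 ?mul0r // mulrC.
Qed.

End DiagonalConjugate.

Section Transition.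
Local Open Scope classical_set_scope.
Variables (R : realType) (T : finType) (e : rel T).
Let C : numClosedFieldType := R[i].
Local Notation A := (adjacency_mx e C).
Local Notation n := #|T|.

(** Powers of the conjugated matrix act on the diagonal only, so each entry of a partial sum is a
    finite combination of scalar exponential series. *)
Lemma transition_mx_conj_diag (P : 'M[C]_n) (d : 'rV[C]_n) (t : R) :
  P \in unitmx -> (forall j, d 0 j \is Num.real) ->
  A = invmx P *m diag_mx d *m P ->
  transition_mx e t =
    invmx P *m diag_mx (map_mx (fun x => cis (t * complex.Re x)) d) *m P.
Proof.
move=> Pu dreal AE; apply: (@mx_cvg_lim C); apply/mx_cvgP => i j.
rewrite conj_diag_mxE.
under eq_bigr do rewrite mxE.
have -> : (fun k => series (fun k0 => k0`!%:R^-1 *: (('i%C * t%:C%C) *: A) ^+ k0) k i j) =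
  (fun k => \sum_l @series C (fun k0 => k0`!%:R^-1 * ('i%C * (t * complex.Re (d 0 l))%:C%C) ^+ k0) k
       * (invmx P i l * P l j)).
  apply/funext => k; rewrite /series /= summxE.
  under [RHS]eq_bigr do rewrite mulr_suml.
  rewrite exchange_big; apply: eq_bigr => k0 _.
  rewrite AE scalemxAl scalemxAr -linearZ /= conj_diag_mxX // mxE conj_diag_mxE mulr_sumr.
  apply: eq_bigr => l _; rewrite !mxE mulrA; congr (_ * _ ^+ _ * _).
  by rewrite rmorphM /= RRe_real // mulrA.
apply: (@cvg_big_sum C) => l; apply: cvgMl; exact: cvg_series_cis.
Qed.
End Transition.

(** * Transition matrices of symmetric graphs *)

Section SymmetricGraph.
Local Open Scope sesquilinear_scope.
Variables (R : realType) (T : finType) (e : rel T) (t : R).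
Hypothesis e_sym : symmetric e.
Let C : numClosedFieldType := R[i].
Local Notation A := (adjacency_mx e C).
Local Notation U := (transition_mx e t : 'M[C]_#|T|).
Let f (x : C) : C := cis (t * complex.Re x).

Lemma tr_adjacency_mx : A^T = A.
Proof. by apply/matrixP => i j; rewrite !mxE e_sym. Qed.

Lemma adjacency_spectral : exists (P : 'M[C]_#|T|) (d : 'rV[C]_#|T|),
  [/\ P \is unitarymx, forall j, d 0 j \is Num.real,
      A = invmx P *m diag_mx d *m P &
      U = invmx P *m diag_mx (map_mx f d) *m P].
Proof.
have Ah : A \is hermsymmx.
  apply/is_hermitianmxP; rewrite expr0 scale1r tr_adjacency_mx.
  by apply/matrixP => i j; rewrite !mxE conjC_nat.
have dr j : spectral_diag A 0 j \is Num.real.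
  by have /mxOverP := hermitian_spectral_diag_real Ah.
have AE := orthomx_spectralP (hermitian_normalmx Ah).
exists (spectralmx A), (spectral_diag A); split=> //.
- exact: spectral_unitarymx.
- by apply: transition_mx_conj_diag => //; exact: spectral_unit.
Qed.

Lemma transition_mx_unitary : U *m U ^t* = 1%:M.
Proof.
have [P [d [Pu dr _ ->]]] := adjacency_spectral.
have Punit := unitarymx_unit Pu.
rewrite invmx_unitary // !trmx_mul !map_mxM trmxCK tr_diag_mx map_diag_mx.
rewrite !mulmxA [_ *m P *m _]mulmxtVK // -[_ *m diag_mx _ *m diag_mx _]mulmxA mulmx_diag.
rewrite (_ : \row_j _ = const_mx 1) ?diag_const_mx ?mulmx1; last first.
  apply/rowP => j; rewrite !mxE [X in _ * X]conj_cis -cisD subrr; exact: cis0.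
by rewrite -invmx_unitary // mulVmx.
Qed.

Lemma tr_transition_mx : U^T = U.
Proof.
have [P [d [/unitarymx_unit Pu dr AE ->]]] := adjacency_spectral.
have PTu : P^T \in unitmx by rewrite unitmx_tr.
(* Symmetry of [A] makes [P *m P^T] commute with the diagonal matrix of eigenvalues, hence with its
   image under [f]. *)
have : (P *m P^T) *m diag_mx d = diag_mx d *m (P *m P^T).
  have := tr_adjacency_mx; rewrite {1}AE !trmx_mul tr_diag_mx trmx_inv => /(congr1 (mulmx P)).
  rewrite AE !mulmxA mulmxV // mul1mx => /(congr1 (mulmxr P^T)) /=.
  by rewrite mulmxKV // !mulmxA.
move/(diag_mx_intertwine f) => E.
rewrite !trmx_mul tr_diag_mx trmx_inv.
apply: (can_inj (mulKmx Pu)); apply: (can_inj (mulmxK PTu)).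
by rewrite !mulmxA mulmxV // mul1mx mulmxKV // E !mulmxA.
Qed.

Lemma transition_mx_comm (B : 'M[C]_#|T|) : A *m B = B *m A -> U *m B = B *m U.
Proof.
have [P [d [/unitarymx_unit Pu dr AE ->]]] := adjacency_spectral.
rewrite {}AE => E.
have : (P *m B *m invmx P) *m diag_mx d = diag_mx d *m (P *m B *m invmx P).
  have := congr1 (fun X => P *m X *m invmx P) E.
  by rewrite !mulmxA mulmxV // mul1mx mulmxK.
move/(diag_mx_intertwine f) => {}E.
apply: (can_inj (mulKmx Pu)); have := congr1 (mulmxr P) E.
by rewrite /= !mulmxA !mulmxV // !mul1mx mulmxKV.
Qed.

(** The row [v *m invmx P] intertwines [d] with the 1 by 1 matrix [a]. At a nonzero coordinate [j]
    of this row, [a = d 0 j], so [a] is real. *)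
Lemma transition_mx_eigen (v : 'rV[C]_#|T|) (a : C) : v != 0 -> v *m A = a *: v ->
  a \is Num.real /\ v *m U = f a *: v.
Proof.
have [P [d [/unitarymx_unit Pu dr AE ->]]] := adjacency_spectral.
rewrite {}AE => v0 E.
have E' : (v *m invmx P) *m diag_mx d = diag_mx (const_mx a) *m (v *m invmx P).
  by rewrite diag_const_mx mul_scalar_mx scalemxAl -E !mulmxA mulmxK.
have vE : v = v *m invmx P *m P by rewrite mulmxKV.
split; last first.
  have := diag_mx_intertwine f E'; rewrite map_const_mx diag_const_mx mul_scalar_mx.
  by rewrite !mulmxA => ->; rewrite -scalemxAl -vE.
have /rV0Pn[j wj] : v *m invmx P != 0.
  by apply: contra_neq v0 => w0; rewrite vE w0 mul0mx.
move: (v *m invmx P) wj E' => w wj /rowP/(_ j); rewrite mul_mx_diag mul_diag_mx !mxE.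
by rewrite mulrC => /(mulIf wj) <-.
Qed.
End SymmetricGraph.

(** * Integer combinations of translations *)

Section Translation.
Variables (gT : finGroupType).

(** Row vectors are read as functions on the group; multiplication by this matrix sends f to the
    function x |-> f(g x). *)
Definition trans_mx (K : pzRingType) (g : gT) : 'M[K]_#|gT| :=
  \matrix_(i, j) (enum_val i == (g * enum_val j)%g)%:R.

Lemma mul_trans_mx (K : pzRingType) m (v : 'M[K]_(m, #|gT|)) g i j :
  (v *m trans_mx K g) i j = v i (enum_rank (g * enum_val j)%g).
Proof.
rewrite mxE (bigD1 (enum_rank (g * enum_val j)%g)) //= mxE enum_rankK eqxx mulr1.
rewrite big1 ?addr0 // => k kj; rewrite mxE (negPf (_ : enum_val k != _)) ?mulr0 //.
by apply: contra_neq kj => <-; rewrite enum_valK.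
Qed.

Lemma trans_mxM (K : pzRingType) g h :
  trans_mx K g *m trans_mx K h = trans_mx K (g * h)%g.
Proof. by apply/matrixP => i j; rewrite mul_trans_mx !mxE enum_rankK mulgA. Qed.

Definition comb_mx (K : pzRingType) (H : {set gT}) (c : gT -> K) : 'M[K]_#|gT| :=
  \sum_(h in H) c h *: trans_mx K h.

Lemma comb_mxE (K : pzRingType) (H : {set gT}) (c : gT -> K) i j :
  comb_mx H c i j =
    (let h := (enum_val i * (enum_val j)^-1)%g in if h \in H then c h else 0).
Proof.
rewrite /= summxE; set h := (_ * _)%g.
have E g : (c g *: trans_mx K g) i j = c g * (g == h)%:R.
  rewrite !mxE; congr (_ * (_)%:R); rewrite /h eq_sym (can2_eq (mulgK _) (mulgKV _)) //.
under eq_bigr do rewrite E.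
case: ifP => hH; last first.
  by rewrite big1 // => g gH; case: eqP => [gh|_]; [rewrite gh hH in gH | rewrite mulr0].
rewrite (bigD1 h) //= eqxx mulr1 big1 ?addr0 // => g /andP[_ /negPf ->].
by rewrite mulr0.
Qed.

Lemma map_comb_mx (K L : pzRingType) (f : {rmorphism K -> L}) H c :
  map_mx f (comb_mx H c) = comb_mx H (f \o c).
Proof.
by apply/matrixP => i j; rewrite !mxE !comb_mxE /=; case: ifP => // _; rewrite rmorph0.
Qed.

Lemma F2_addrr n (X : 'M['F_2]_n) : X + X = 0.
Proof.
apply/matrixP => i j; rewrite !mxE -mulr2n -mulr_natl.
by rewrite (_ : 2%:R = 0) ?mul0r //; exact/val_inj.
Qed.

(** In characteristic 2 the two copies of each cross term cancel. *)
Lemma F2_sqrr_sum n (I : eqType) (r : seq I) (F : I -> 'M['F_2]_n) :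
  (forall i j, i \in r -> j \in r -> F i *m F j = F j *m F i) ->
  (\sum_(i <- r) F i) *m (\sum_(i <- r) F i) = \sum_(i <- r) F i *m F i.
Proof.
elim: r => [|i r IH] Fc; first by rewrite !big_nil mul0mx.
rewrite !big_cons mulmxDl !mulmxDr IH; last first.
  by move=> j k jr kr; apply: Fc; rewrite inE ?jr ?kr orbT.
have -> : (\sum_(j <- r) F j) *m F i = F i *m \sum_(j <- r) F j.
  rewrite mulmx_suml mulmx_sumr; apply: eq_big_seq => j jr.
  by apply: Fc; rewrite !inE ?jr ?eqxx ?orbT.
by rewrite addrA -[F i *m F i + _ + _]addrA F2_addrr addr0.
Qed.

Lemma F2_comb_mxX (H : {group gT}) (c : gT -> 'F_2) r : abelian H ->
  comb_mx H c ^+ (2 ^ r) = \sum_(h in H) c h *: trans_mx 'F_2 (h ^+ (2 ^ r))%g.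
Proof.
move=> /centsP abH; elim: r => [|r IH].
  by rewrite expn0 expr1; apply: eq_bigr => h _; rewrite expg1.
rewrite expnSr exprM IH expr2 -!big_enum /= -/(_ *m _) [LHS]F2_sqrr_sum; last first.
  move=> x y; rewrite !mem_enum => xH yH.
  rewrite -!scalemxAl -!scalemxAr !trans_mxM !scalerA mulrC; congr (_ *: trans_mx _ _).
  by apply: (centsP (_ : abelian H)); rewrite ?groupX //; apply/centsP.
apply: eq_bigr => h _; rewrite -scalemxAl -scalemxAr scalerA trans_mxM -expgD addnn -muln2.
(* Each coefficient in F_2 is its own square. *)
by congr (_ *: _); case: (c h) => -[|[|]] // i; exact/val_inj.
Qed.

(* Modulo 2 the combination [X] is nilpotent; but Frobenius raises each [h] to a
   power of 2, so [X ^+ (2 ^ r) = X] whenever [2 ^ r = 1] modulo [#|H|]. *)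
Lemma even_comb_coef (H : {group gT}) (c : gT -> int) (s : seq int) :
  abelian H -> odd #|H| ->
  \prod_(k <- s) (comb_mx H c - (2 * k)%:M) = 0 ->
  forall h, h \in H -> (2 %| c h)%Z.
Proof.
move=> abH oH p0 h hH; pose X := comb_mx H ((intr : int -> 'F_2) \o c).
have Xs : X ^+ (size s) = 0.
  have := congr1 (map_mx (intr : int -> 'F_2)) p0; rewrite map_mx0 => <-.
  elim: s {p0} => [|k s IH]; first by rewrite big_nil expr0 map_mx1.
  rewrite big_cons exprS IH map_mxM map_mxB map_comb_mx map_scalar_mx.
  rewrite rmorphM /= (_ : 2%:~R = 0); last exact/val_inj.
  by rewrite mul0r raddf0 subr0.
(* The totient gives 2^r = 1 modulo [#|H|] by Euler; the factor [size s] ensures that 2^r is at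
   least the nilpotency exponent. *)
pose r := (totient #|H| * size s)%N.
have XX : X ^+ (2 ^ r) = X.
  rewrite F2_comb_mxX //; apply: eq_bigr => g gH; congr (_ *: trans_mx _ _).
  have : (2 ^ r = 1 %[mod #|H|])%N.
    by rewrite /r expnM -modnXm Euler_exp_totient ?coprime2n // modnXm exp1n.
  by move=> E; rewrite -(expg_mod _ (expg_cardG gH)) E expg_mod ?expg1 ?expg_cardG.
have X0 : X = 0.
  have ler : (size s <= 2 ^ r)%N.
    apply: leq_trans (ltnW (ltn_expl r _)) => //.
    by rewrite /r leq_pmull // totient_gt0 cardG_gt0.
  by rewrite -XX -(subnK ler) exprD Xs mulr0.
have /matrixP/(_ (enum_rank h) (enum_rank 1%g)) := X0.
rewrite comb_mxE /= !enum_rankK invg1 mulg1 hH mxE /=.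
by move/eqP; rewrite -(dvdz_pcharf (pchar_Fp _)).
Qed.

End Translation.

(** * Integer matrices with prescribed eigenvalues, and divisibility by 4 *)

Lemma prod_sub_scalar_mx_eq0 (K : comNzRingType) n (B : 'M[K]_n) (s : seq K) :
  char_poly B = \prod_(k <- s) ('X - k%:P) -> \prod_(k <- s) (B - k%:M) = 0.
Proof.
case: n B => [|n] B Bs; first exact: thinmx0.
rewrite -[RHS](Cayley_Hamilton B) Bs rmorph_prod; apply: eq_bigr => k _.
by rewrite rmorphB /= horner_mx_X horner_mx_C.
Qed.

(** Over [K] the characteristic polynomial splits into factors X - m k with k an integer. As the
    integers embed in [K], this factorisation already holds over them, and Cayley-Hamilton
    applies. *)
Lemma int_mx_annihilator (K : numClosedFieldType) n (B : 'M[int]_n) (m : int) :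
  (forall a : K, eigenvalue (map_mx intr B) a -> exists k : int, a = (m * k)%:~R) ->
  exists s : seq int, \prod_(k <- s) (B - (m * k)%:M) = 0.
Proof.
move=> Bm; have [r rE] := closed_field_poly_normal (char_poly (map_mx (intr : int -> K) B)).
rewrite (monicP (char_poly_monic _)) scale1r in rE.
have [s sE] : exists s : seq int, r = [seq (m * k)%:~R | k <- s].
  have : forall a, a \in r -> exists k : int, a = (m * k)%:~R.
    by move=> a ar; apply: Bm; rewrite eigenvalue_root_char rE root_prod_XsubC.
  elim: (r) => [|a r' IH] r'E; first by exists nil.
  have [k ->] := r'E a (mem_head _ _); have [|s ->] := IH.
    by move=> b br; apply: r'E; rewrite inE br orbT.
  by exists (k :: s).
exists s; rewrite -(big_map (fun k => m * k) xpredT (fun k => B - k%:M)).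
apply: prod_sub_scalar_mx_eq0.
apply: (@map_inj_poly _ _ (intr : int -> K)) => //; first exact: intr_inj.
rewrite map_char_poly rE sE rmorph_prod /= !big_map; apply: eq_bigr => k _.
by rewrite rmorphB /= map_polyX map_polyC.
Qed.

(** The parity result is applied twice, first to [c] and then to its half [c']. *)
Lemma comb_coef_dvd4 (gT : finGroupType) (H : {group gT}) (c : gT -> int) (s : seq int) :
  abelian H -> odd #|H| ->
  \prod_(k <- s) (comb_mx H c - (4 * k)%:M) = 0 ->
  forall h, h \in H -> (4 %| c h)%Z.
Proof.
move=> abH oH p0.
have c2 h : h \in H -> (2 %| c h)%Z.
  apply: (@even_comb_coef _ _ _ [seq 2 * k | k <- s]) => //.
  rewrite big_map -[RHS]p0; apply: eq_bigr => k _; congr (_ - _%:M); ring.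
pose c' h := (c h %/ 2)%Z.
have cE h : h \in H -> c h = 2 * c' h by move/c2/divzK; rewrite mulrC.
have c2' h : h \in H -> (2 %| c' h)%Z.
  apply: (@even_comb_coef _ _ _ s) => //.
  (* Doubling every factor of the product for [c'] gives the product for [c]; the power of 2 can be
     cancelled over the integers. *)
  have /matrixP E : 2 ^+ size s *: \prod_(k <- s) (comb_mx H c' - (2 * k)%:M) = 0.
    rewrite -[RHS]p0; elim: (s) => [|k s' IH]; first by rewrite !big_nil expr0 scale1r.
    rewrite !big_cons exprS -IH -[RHS]/(_ *m _) -scalemxAr mulrC -scalerA.
    have F (X Y : 'M[int]_#|gT|) : 2 *: (X * Y) = (2 *: X) *m Y by exact: scalemxAl.
    rewrite F scalerBr scale_scalar_mx (_ : 2 * (2 * k) = 4 * k); last by ring.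
    congr (_ *: (_ *m _)); congr (_ - _); rewrite /comb_mx scaler_sumr; apply: eq_bigr => g gH.
    by rewrite scalerA -cE.
  apply/matrixP => i j; have /eqP := E i j; rewrite !mxE mulf_eq0 expf_eq0 andbF /=.
  by move=> /eqP.
by move=> h hH; rewrite cE // (dvdz_mul (dvdzz 2) (c2' h hH)).
Qed.

(** * Perfect state transfer on Cayley graphs *)

Section CayleyTransfer.
Variables (R : realType) (gT : finGroupType) (S : {set gT}).
Hypothesis SV : forall x : gT, x \in S -> x^-1%g \in S.
Let C : numClosedFieldType := R[i].
Local Notation A := (adjacency_mx (Cay S) C).
Local Notation rk := (@enum_rank gT).

Lemma Cay_sym : symmetric (Cay S).
Proof.
have H x y : Cay S x y -> Cay S y x by move=> /SV; rewrite /Cay invMg invgK.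
by move=> x y; apply/idP/idP; exact: H.
Qed.

(** At (x, y) the adjacency matrix tests y x^-1, whereas the translations test x y^-1; inverse
    closure of [S] reconciles the two. *)
Lemma adjacency_CayE : A = \sum_(s in S) trans_mx C s.
Proof.
apply/matrixP => i j; rewrite mxE Cay_sym /Cay summxE.
set g := (_ * _)%g.
have E s : trans_mx C s i j = (s == g)%:R.
  by rewrite !mxE /g eq_sym (can2_eq (mulgK _) (mulgKV _)).
under eq_bigr do rewrite E.
case: (boolP (g \in S)) => gS; last first.
  by rewrite big1 // => s sS; case: eqP => // sg; rewrite -sg sS in gS.
by rewrite (bigD1 g) //= eqxx big1 ?addr0 // => s /andP[_ /negPf ->].
Qed.

(** Right translations are automorphisms of the Cayley graph, so their permutation matrix [Q]
    commutes with [A], hence with the transition matrix. *)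
Lemma transition_mx_rtrans (t : R) (x y g : gT) :
  transition_mx (Cay S) t (rk x) (rk (y * g)%g) =
  transition_mx (Cay S) t (rk (x * g^-1)%g) (rk y).
Proof.
pose Q : 'M[C]_#|gT| := \matrix_(i, j) (enum_val i == (enum_val j * g)%g)%:R.
have MQ (M : 'M[C]_#|gT|) u v : (M *m Q) (rk u) (rk v) = M (rk u) (rk (v * g)%g).
  rewrite mxE (bigD1 (rk (v * g)%g)) //= mxE !enum_rankK eqxx mulr1.
  rewrite big1 ?addr0 // => k kj; rewrite mxE enum_rankK (negPf (_ : enum_val k != _)) ?mulr0 //.
  by apply: contra_neq kj => <-; rewrite enum_valK.
have QM (M : 'M[C]_#|gT|) u v : (Q *m M) (rk u) (rk v) = M (rk (u * g^-1)%g) (rk v).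
  rewrite mxE (bigD1 (rk (u * g^-1)%g)) //= mxE !enum_rankK mulgKV eqxx mul1r.
  rewrite big1 ?addr0 // => k kj; rewrite mxE enum_rankK (negPf (_ : u != _)) ?mul0r //.
  by apply: contra_neq kj => ->; rewrite mulgK enum_valK.
have AQ : A *m Q = Q *m A.
  apply/matrixP => i j; rewrite -(enum_valK i) -(enum_valK j) MQ QM !mxE !enum_rankK.
  by rewrite /Cay invMg invgK mulgA.
by have /matrixP/(_ (rk x) (rk y)) := @transition_mx_comm R _ _ t Cay_sym Q AQ; rewrite MQ QM.
Qed.

Lemma perfect_state_transfer_trans : perfect_state_transfer (Cay S) R ->
  exists (z : gT) (t : R) (l : C),
    [/\ z != 1%g, (z * z = 1)%g, forall s, s \in S -> (z * s * z)%g \in S,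
        l != 0 & transition_mx (Cay S) t = l *: trans_mx C z].
Proof.
move=> [u [v [t [uv Uvu]]]]; pose U : 'M[C]_#|gT| := transition_mx (Cay S) t.
have UE x y : U (rk x) (rk y) = U (rk (x * y^-1)%g) (rk 1%g).
  by rewrite -[y in LHS]mul1g; exact: transition_mx_rtrans.
pose z := (v * u^-1)%g; pose l : C := U (rk z) (rk 1%g).
have l1 : `|l| = 1 :> C by rewrite /l -UE.
have l0 : l != 0 by rewrite -normr_gt0 l1; exact: ltr01.
(* Row [z] of the unitary matrix [U] has norm one, and its entry [l] already has modulus one. *)
have Uz k : k != 1%g -> U (rk z) (rk k) = 0.
  move=> k1; have /matrixP/(_ (rk z) (rk z)) := @transition_mx_unitary R _ _ t Cay_sym.
  rewrite -/U [RHS]mxE eqxx mxE (bigD1 (rk 1%g)) //= !mxE -normCK -/l l1 expr1n.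
  rewrite -[RHS]addr0 => /addrI; under eq_bigr do rewrite !mxE -normCK.
  move/psumr_eq0P => /(_ (fun j _ => exprn_ge0 2 (normr_ge0 _)) (rk k)).
  rewrite (inj_eq enum_rank_inj) k1 => /(_ isT) /eqP.
  by rewrite expf_eq0 /= normr_eq0 => /eqP.
have U1 g : U (rk g) (rk 1%g) = l * (g == z)%:R.
  case: eqP => [->|/eqP gz]; first by rewrite mulr1.
  rewrite mulr0 -(Uz (g^-1 * z)%g); first by rewrite [RHS]UE invMg invgK mulKVg.
  by apply: contra_neq gz => gz1; rewrite -[g]mulg1 -gz1 mulKVg.
have UT : U = l *: trans_mx C z.
  apply/matrixP => i j; rewrite -(enum_valK i) -(enum_valK j) UE U1 !mxE !enum_rankK.
  by rewrite (can2_eq (mulgKV _) (mulgK _)).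
(* Symmetry of [U] at (z, 1): the entry at (1, z) is again [l], so [z^-1] must be [z]. *)
have zV : z^-1%g = z.
  have := @tr_transition_mx R _ _ t Cay_sym; rewrite -/U => /matrixP/(_ (rk z) (rk 1%g)).
  rewrite mxE UE mul1g U1 -/l -[RHS]mulr1 => /(mulfI l0).
  by case: eqP => // _ /eqP; rewrite eq_sym oner_eq0.
have zz : (z * z = 1)%g by rewrite -{1}zV mulVg.
have Az : A *m trans_mx C z = trans_mx C z *m A.
  have := @transition_mx_comm R _ _ t Cay_sym A erefl; rewrite -/U UT.
  by rewrite -scalemxAl -scalemxAr => /(scalerI l0).
exists z, t, l; split=> //; first by rewrite -eq_mulgV1 eq_sym.
move=> s sS.
(* At (1, s z) the left side tests whether z s z is in [S], and the right side whether s is. *)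
have /matrixP/(_ (rk 1%g) (rk (s * z))%g) := Az.
rewrite mul_trans_mx enum_rankK !mxE (bigD1 (rk z)) //= big1; last first.
  move=> k kz; rewrite mxE !enum_rankK (negPf (_ : 1%g != _)) ?mul0r //.
  by apply: contra_neq kz => zk; rewrite -(enum_valK k) -(mulKg z (enum_val k)) -zk mulg1 zV.
rewrite !mxE !enum_rankK zz eqxx mul1r addr0 /Cay invg1 mulg1 mulgK sS mulgA.
by case: (_ \in S) => // /eqP; rewrite eq_sym oner_eq0.
Qed.

Lemma adjacency_Cay_eigen (f : gT -> C) (a : C) :
  (forall x, \sum_(s in S) f (s * x)%g = a * f x) ->
  (\row_j f (enum_val j)) *m A = a *: \row_j f (enum_val j).
Proof.
move=> fa; apply/rowP => j; rewrite adjacency_CayE mulmx_sumr summxE !mxE -fa.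
by apply: eq_bigr => s _; rewrite mul_trans_mx mxE enum_rankK.
Qed.

(** The transition matrix acts on [f] both as a function of [A] and as [l] times the translation by
    [z]; the two factors are compared at [x0], where [f] is nonzero. *)
Lemma transfer_eigenvalue (t : R) (z : gT) (l b a : C) (f : gT -> C) (x0 : gT) :
  transition_mx (Cay S) t = l *: trans_mx C z ->
  f x0 != 0 -> (forall x, f (z * x)%g = b * f x) ->
  (forall x, \sum_(s in S) f (s * x)%g = a * f x) ->
  a \is Num.real /\ cis (t * complex.Re a) = l * b.
Proof.
move=> UE fx0 fz /adjacency_Cay_eigen fA.
have f0 : (\row_(j < #|gT|) f (enum_val j)) != 0 :> 'rV[C]_#|gT|.
  by apply/rV0Pn; exists (rk x0); rewrite mxE enum_rankK.
have [aR E0] := transition_mx_eigen t Cay_sym f0 fA; split=> //.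
move: E0; rewrite UE -scalemxAr => /rowP/(_ (rk x0)).
rewrite mxE mul_trans_mx !mxE !enum_rankK fz mulrA => E.
by apply: (mulIf fx0); rewrite E.
Qed.
End CayleyTransfer.

(** * Abelian subgroups of index two *)

Section IndexTwo.
Variables (gT : finGroupType) (H : {group gT}).
Hypothesis indexH : #|[set: gT] : H|%g = 2.

Lemma index2_mulg x y : x \notin H -> y \notin H -> (x * y)%g \in H.
Proof.
move=> xH yH; have E := rcoset_index2 (finset.subsetT H) indexH.
have yV : (y^-1)%g \in [set: gT] :\: H by rewrite !inE groupV yH.
have : x \in [set: gT] :\: H by rewrite !inE xH.
by rewrite -(E _ yV) mem_rcoset invgK.
Qed.

Hypothesis abH : abelian H.
Hypothesis no_central_invol :
  forall z : gT, z \in 'Z([set: gT])%g -> #[z]%g <> 2.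

(* If [z] in [H] is an involution and [x] lies outside [H], then [z * z ^ x] is
   central, because [x ^ 2] is in [H]. *)
Lemma abelian_index2_no_involution z : z \in H -> (z * z = 1)%g -> z = 1%g.
Proof.
move=> zH zz; have HT := index2_normal (finset.subsetT H) indexH.
have [x _ xH] : exists2 x, x \in [set: gT] & x \notin H.
  by apply/fintype.subsetPn; rewrite -indexg_eq1 indexH.
have cH a b : a \in H -> b \in H -> commute a b by move=> aH bH; exact: (centsP abH).
have zxH : (z ^ x)%g \in H by rewrite memJ_norm // (fintype.subsetP (normal_norm HT)) ?inE.
(* An element of the abelian [H] that commutes with [x] is central, because any [y] outside [H]
   equals (y x) x^-1 with y x in [H]. *)
have central w : w \in H -> commute w x -> (w * w = 1)%g -> w = 1%g.
  move=> wH wx ww; apply: contraTeq isT => w1.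
  have /no_central_invol[] : w \in 'Z([set: gT])%g; last exact: nt_prime_order.
  apply/centerP; split=> [|y _]; first by rewrite inE.
  have [yH|yH] := boolP (y \in H); first exact: cH.
  rewrite -(mulgK x y); apply: commuteM; last exact: commuteV.
  by apply: cH => //; exact: index2_mulg.
have zxx : (z ^ (x * x) = z)%g by rewrite /conjg (cH _ _ zH (index2_mulg xH xH)) mulKg.
have w1 : (z * z ^ x = 1)%g.
  apply: central; first exact: groupM.
    by apply/commgP/conjg_fixP; rewrite conjMg -conjgM zxx; exact: cH.
  rewrite mulgA -(mulgA z) (cH (z ^ x)%g z) // !mulgA zz mul1g mulgK.
  by rewrite -(mulgA x^-1%g z z) zz mulg1 mulVg.
(* From z z^x = 1 = z z follows z^x = z, so [z] itself commutes with [x]. *)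
apply: central => //; apply/commgP/conjg_fixP.
by apply: (mulgI z); rewrite w1 zz.
Qed.

Lemma abelian_index2_odd : odd #|H|.
Proof.
apply/negPn/negP; rewrite -dvdn2 => /(Cauchy (isT : prime 2)) [z zH oz].
have : (z * z = 1)%g by rewrite -(expg_order z) oz.
by move/(abelian_index2_no_involution zH) => z1; move: oz; rewrite z1 order1.
Qed.

End IndexTwo.

(** * Transfer through an involution outside [H] *)

Section TransferOutside.
Variables (R : realType) (gT : finGroupType) (H : {group gT}) (S : {set gT}).
Hypothesis indexH : #|[set: gT] : H|%g = 2.
Hypothesis SV : forall x : gT, x \in S -> x^-1%g \in S.
Let C : numClosedFieldType := R[i].
Variables (z : gT) (t : R) (l : C).
Hypothesis zz : (z * z = 1)%g.
Hypothesis zH : z \notin H.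
Hypothesis zSz : forall s, s \in S -> (z * s * z)%g \in S.
Hypothesis l0 : l != 0.
Hypothesis Uz : transition_mx (Cay S) t = l *: trans_mx C z.
Local Notation rk := (@enum_rank gT).

(** This picks the representative in [H] of the pair {x, z x}, a right coset of <z>. *)
Definition fold_coset (x : gT) : gT := if x \in H then x else (z * x)%g.
Local Notation sigma := fold_coset.

Lemma fold_coset_in x : sigma x \in H.
Proof. by rewrite /sigma; case: ifPn => // xH; exact: index2_mulg. Qed.

Lemma mulg_coset x : (z * x \in H)%g = (x \notin H).
Proof.
have [xH|xH] := boolP (x \in H); first by rewrite groupMr // (negPf zH).
by rewrite index2_mulg.
Qed.

Lemma fold_coset_mul x : sigma (z * x) = sigma x.
Proof. by rewrite /sigma mulg_coset; case: (x \in H); rewrite /= ?mulgA ?zz ?mul1g. Qed.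

Lemma fold_cosetM s x : x \in H -> sigma (s * x) = (sigma s * x)%g.
Proof. by move=> xH; rewrite /sigma groupMr //; case: ifP; rewrite ?mulgA. Qed.

Lemma sum_conj_invol (f : gT -> C) : \sum_(s in S) f (z * s * z)%g = \sum_(s in S) f s.
Proof.
have zK : involutive (fun s => z * s * z)%g.
  by move=> s; rewrite !mulgA zz mul1g -mulgA zz mulg1.
rewrite [RHS](reindex_inj (inv_inj zK)); apply: eq_bigl => s.
by apply/idP/idP => [/zSz//|/zSz]; rewrite zK.
Qed.

(* The restriction of [v] to a coset [H x0] on which it is not zero, extended
   [z]-invariantly, is an eigenvector of the adjacency matrix. *)
Lemma fold_eigenvalue (a : C) (v : 'rV[C]_#|gT|) : v != 0 ->
  v *m \sum_(s in S) trans_mx C (sigma s) = a *: v ->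
  a \is Num.real /\ cis (t * complex.Re a) = l.
Proof.
move=> v0 va; have [j vj] := rV0Pn _ v0; pose x0 := enum_val j.
pose f x := v 0 (rk (sigma x * x0)%g).
have fz x : f (z * x)%g = 1 * f x by rewrite mul1r /f fold_coset_mul.
have fH x : x \in H -> \sum_(s in S) f (s * x)%g = a * f x.
  move=> xH; have /rowP/(_ (rk (x * x0)%g)) := va.
  rewrite mulmx_sumr summxE !mxE /f {3}/sigma xH => <-.
  by apply: eq_bigr => s _; rewrite mul_trans_mx enum_rankK fold_cosetM // mulgA.
rewrite -[l]mulr1; apply: (transfer_eigenvalue SV (x0 := 1%g) Uz _ fz) => [|x].
  by rewrite /f /sigma group1 mul1g enum_valK.
have [xH|xH] := boolP (x \in H); first exact: fH.
(* For [x] outside [H], the equation at z x, which is in [H], is transported by the [z]-invariance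
   of [f] and the stability of [S] under s |-> z s z. *)
rewrite -[f x]mul1r -fz -fH ?mulg_coset // -sum_conj_invol.
apply: eq_bigr => s _; rewrite -[LHS]mul1r -fz -!mulgA; congr f.
by rewrite (mulgA z z x) zz mul1g.
Qed.

Let d1 : nat := #|S :\: H|.

(** The constant function has eigenvalue [#|S|] and is fixed by [z]. *)
Lemma transfer_valency : cis (t * #|S|%:R) = l.
Proof.
have [|x|x|_] := @transfer_eigenvalue R gT S SV t z l 1 #|S|%:R (fun=> 1) 1%g Uz.
- exact: oner_neq0.
- by rewrite mulr1.
- by rewrite mulr1 -sumr_const.
- by rewrite -(rmorph_nat (real_complex R)) mulr1.
Qed.

(** The sign character of G / H has eigenvalue |S| - 2 d1 and takes the value -1 at [z]. Dividing
    the valency relation by the resulting one gives cis(2 t d1) = -1. *)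
Lemma transfer_phase : exists m : int, t * (2 * d1)%:R = (2 * m + 1)%:~R * pi.
Proof.
apply: cis_eqN1.
pose f x : C := if x \in H then 1 else -1.
have fM s x : f (s * x)%g = f s * f x.
  rewrite /f; have [xH|xH] := boolP (x \in H).
    by rewrite groupMr // mulr1.
  have [sH|sH] := boolP (s \in H); first by rewrite groupMl // (negPf xH) mul1r.
  by rewrite index2_mulg // mulrNN mulr1.
have sf : \sum_(s in S) f s = #|S|%:R - (2 * d1)%:R.
  have -> : #|S|%:R = \sum_(s in S) 1 :> C by rewrite sumr_const.
  rewrite (big_setID (H : {set gT})) [X in _ = X - _](big_setID (H : {set gT})) /=.
  rewrite -addrA; congr (_ + _).
    by apply: eq_bigr => s /setIP[_ sH]; rewrite /f sH.
  rewrite (eq_bigr (fun=> -1)); last by move=> s /setDP[_ /negPf sH]; rewrite /f sH.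
  by rewrite sumrN !sumr_const natrM -/d1; ring.
have [_ e2] : (\sum_(s in S) f s) \is @Num.real C /\
    cis (t * complex.Re (\sum_(s in S) f s)) = l * -1.
  apply: (transfer_eigenvalue SV (f := f) (x0 := 1%g) Uz) => [|x|x].
  - by rewrite /f group1 oner_neq0.
  - by rewrite fM /f (negPf zH).
  - by rewrite mulr_suml; apply: eq_bigr => s _; rewrite fM.
move: e2; rewrite sf -!(rmorph_nat (real_complex R)) -rmorphB /= mulrBr cisB transfer_valency.
set c := cis _ => E; have c0 : c != 0 by exact: cis_neq0.
move: E => /(mulfI l0) /(canRL (invrK)); rewrite invrN invr1.
exact.
Qed.

Hypothesis abH : abelian H.
Hypothesis oddH : odd #|H|.
Hypothesis S1 : 1%g \notin S.
Let fib (h : gT) : nat := #|[set s in S | sigma s == h]|.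

Lemma sum_trans_fold (K : pzRingType) :
  \sum_(s in S) trans_mx K (sigma s) = comb_mx H (fun h => (fib h)%:R).
Proof.
rewrite (partition_big sigma (mem H)) => [|s _]; last exact: fold_coset_in.
apply: eq_bigr => h _; rewrite scaler_nat -sumr_const.
by apply: eq_big => s => [|/andP[_ /eqP->] //]; rewrite inE.
Qed.

Lemma fold_fiber_dvd4 h : h \in H -> h != 1%g -> (4 %| fib h)%N.
Proof.
move=> hH h1; have [m mE] := transfer_phase; set n := 2 * m + 1 in mE.
have n0 : n != 0 by rewrite /n; lia.
(* These are the coefficients of n (b - |S|), where b is the sum of the folded elements of [S]. *)
pose c g : int := n * ((fib g)%:R - #|S|%:R * (g == 1%g)%:R).
have cE : map_mx intr (comb_mx H c) =
    n%:~R *: (\sum_(s in S) trans_mx C (sigma s) - #|S|%:R%:M).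
  rewrite map_comb_mx sum_trans_fold; apply/matrixP => i j.
  rewrite [RHS]mxE [X in _ * X]mxE [X in _ + X]mxE !comb_mxE /= mxE.
  rewrite -(inj_eq enum_val_inj) eq_mulgV1.
  case: ifPn => [_|gH].
    by rewrite /c rmorphM rmorphB rmorphM /= !rmorph_nat mulr_natr.
  by rewrite (negPf (_ : _ != 1%g)) /= ?mulr0n ?subr0 ?mulr0 //; apply: contraNneq gH => ->.
have [a|s s0] := @int_mx_annihilator C _ (comb_mx H c) 4.
  rewrite cE => /eigenvalueP[v va v0].
  have nC : n%:~R != 0 :> C by rewrite intr_eq0.
  have [] := @fold_eigenvalue (a / n%:~R + #|S|%:R) v v0.
    apply: (scalerI nC); rewrite scalerA mulrDr mulrCA mulfV // mulr1 scalerDl -va.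
    by rewrite -scalemxAr mulmxBr scalerBr mul_mx_scalar scalerA subrK.
  set r := complex.Re _ => aR; rewrite -transfer_valency => E1.
  have aE : a = (n%:~R * (r - #|S|%:R))%:C%C.
    rewrite rmorphM rmorphB rmorph_int rmorph_nat /= RRe_real //.
    by rewrite addrK mulrC divfK.
  have [k kE] : exists k : int, t * (r - #|S|%:R) = k%:~R * (pi *+ 2).
    by apply: cis_eq1; rewrite mulrBr cisB E1 divff ?cis_neq0.
  (* Here t a = 2 k n pi, and n pi = 2 t d1, so that a = 4 k d1 after cancelling [t]. *)
  exists (k * d1%:R); rewrite aE -(rmorph_int (real_complex R)); congr (_%:C%C).
  have t0 : t != 0.
    apply/eqP => t0; move: mE => /esym/eqP.
    by rewrite t0 mul0r mulf_eq0 intr_eq0 (gt_eqF (pi_gt0 R)) (negPf n0).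
  apply: (mulfI t0); rewrite mulrCA kE rmorphM rmorphM /= rmorph_nat.
  rewrite mulrCA -[pi *+ 2]mulr_natr (mulrA n%:~R) -mE natrM.
  ring.
have := comb_coef_dvd4 abH oddH s0 hH; rewrite /c (negPf h1) mulr0 subr0.
(* The odd [n] is coprime to 4, by the Bezout identity n^2 - 4 (m^2 + m) = 1. *)
rewrite Gauss_dvdzr; last by apply/coprimezP; exists (- (m * m + m), n); rewrite /n /=; ring.
by rewrite (natz (fib h)) dvdzE.
Qed.

(** A fibre of the folding map has at most two elements, so one divisible by 4 in size is empty.
    Hence every element of [S] folds to 1, and is [z] since 1 is excluded. *)
Lemma transfer_connection_set : S = [set z].
Proof.
have sz s : s \in S -> s = z.
  move=> sS; have [s1|s1] := eqVneq (sigma s) 1%g.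
    move: s1; rewrite /sigma; case: ifP => [_ s1|_ zs1]; first by case/negP: S1; rewrite -s1.
    by apply: (mulgI z); rewrite zs1 zz.
  have fpos : (0 < fib (sigma s))%N.
    by apply/card_gt0P; exists s; rewrite inE sS eqxx.
  have fle2 : (fib (sigma s) <= 2)%N.
    apply: leq_trans (_ : #|[set sigma s; (z * sigma s)%g]| <= 2)%N.
      apply/subset_leq_card/fintype.subsetP => r; rewrite !inE => /andP[_ /eqP <-].
      by rewrite /sigma; case: ifP => _; rewrite ?mulgA ?zz ?mul1g eqxx ?orbT.
    by rewrite cards2; case: (_ != _).
  by have /(dvdn_leq fpos) := fold_fiber_dvd4 (fold_coset_in s) s1; lia.
apply/setP => s; rewrite inE; apply/idP/eqP => [/sz//|->].
(* It remains to see that [S] is nonempty: [d1 = 0] would make an odd multiple of pi vanish. *)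
have [m mE] := transfer_phase.
have : (0 < d1)%N.
  rewrite lt0n; apply/eqP => d0; move: mE; rewrite d0 muln0 mulr0 => /esym/eqP.
  by rewrite mulf_eq0 intr_eq0 (gt_eqF (pi_gt0 R)) orbF; lia.
by case/card_gt0P => r /setDP[rS _]; rewrite -(sz r rS).
Qed.

End TransferOutside.

(* Perfect state transfer over an abelian subgroup of index two *)
Local Close Scope ring_scope.

Lemma perfect_state_transfer_Cay_index2 (R : realType) (gT : finGroupType) (H : {group gT})
    (S : {set gT}) :
  abelian H -> #|[set: gT] : H|%g = 2 ->
  (forall z : gT, z \in 'Z([set: gT])%g -> #[z]%g <> 2) ->
  1%g \notin S -> (forall x : gT, x \in S -> x^-1%g \in S) ->
  perfect_state_transfer (Cay S) R -> exists s : gT, #[s]%g = 2 /\ S = [set s].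
Proof.
move=> abH iH nc S1 SV /(perfect_state_transfer_trans SV)[z [t [l [z1 zz zSz l0 Uz]]]].
exists z; split; first exact: nt_prime_order.
have zH : z \notin H.
  by apply: contra_neqN z1 => zH; exact: (abelian_index2_no_involution iH abH nc zH zz).
exact: (transfer_connection_set iH SV zz zH zSz l0 Uz abH (abelian_index2_odd iH abH nc) S1).
Qed.

Theorem corollary5p5 (R : realType) (gT : finGroupType) (H : {group gT})
    (abH : abelian H) (indexH : #|[set: gT] : H|%g = 2)
    (no_central_invol : forall z : gT, z \in 'Z([set: gT])%g -> #[z]%g <> 2)
    (S : {set gT}) (S1 : 1%g \notin S)
    (SV : forall x : gT, x \in S -> x^-1%g \in S) :
  (perfect_state_transfer (Cay S) R ->
     (exists s : gT, #[s]%g = 2 /\ S = [set s]) /\ perfect_matching (Cay S))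
  /\ (connected_graph (Cay S) -> ~ perfect_state_transfer (Cay S) R).
Proof.
have Ss := @perfect_state_transfer_Cay_index2 R _ _ _ abH indexH no_central_invol S1 SV.
split=> [pst|conn /Ss[s [os SE]]].
  split; first exact: Ss pst.
  have [s [_ SE]] := Ss pst; move=> x; rewrite /degree -(card1 (s * x)%g).
  by apply: eq_card => y; rewrite !inE /Cay SE inE (can2_eq (mulgKV x) (mulgK x)).
(* The subgroup generated by [s] is a union of components, so connectedness makes it the whole
   group. Then [s] is a central involution, which is excluded. *)
have sG g : g \in <[s]>%g.
  have cl : fingraph.closed (Cay S) (mem <[s]>%g).
    move=> x y; rewrite /Cay SE inE => /eqP yx.
    by rewrite -(mulgKV x y) yx /= groupMl // cycle_id.
  by rewrite -(closed_connect cl (conn 1%g g)) group1.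
apply: (no_central_invol s _ os); apply/centerP; split=> [|g _]; first by rewrite inE.
by have /cycleP[i ->] := sG g; exact: commuteX.
Qed.
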